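(* $\mathfrak{ros}(\ell_1)=\mathfrak{r}$.
   Context: Scalars are either all real or all complex. For $A\subseteq\mathbb{N}$ let $P_A$ be the operator $f\mapsto f\cdot 1_A$ (multiplication by the characteristic function of $A$), acting on $\ell_1$. Let $\mathcal{B}_0(\ell_1)$ be the set of bounded linear operators $T:\ell_1\to\ell_1$ with zero diagonal, i.e. $T(1_{\{n\}})(n)=0$ for all $n\in\mathbb{N}$. For $T\in\mathcal{B}_0(\ell_1)$ and $\varepsilon>0$ let $Ros_{T,\varepsilon}=\{A\subseteq\mathbb{N}\text{ infinite}:\|P_ATP_A\|\le\varepsilon\|T\|\}$. $\mathfrak{ros}(\ell_1)$ is the minimal cardinality of a family $\mathcal{G}$ of infinite subsets of $\mathbb{N}$ such that $\mathcal{G}\cap Ros_{T,\varepsilon}\neq\emptyset$ for all $T\in\mathcal{B}_0(\ell_1)$ and $\varepsilon>0$. The reaping number $\mathfrak{r}$ is the minimal cardinality of a family $\mathcal{F}$ of infinite subsets of $\mathbb{N}$ such that there is no $S\subseteq\mathbb{N}$ with $F\cap S$ and $F\setminus S$ both infinite for all $F\in\mathcal{F}$. *)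

(* Defs.v *)
From mathcomp Require Import all_boot all_order all_algebra.
From mathcomp Require Import all_classical all_reals all_analysis.
From mathcomp Require Import complex.

Set Implicit Arguments.
Unset Strict Implicit.
Unset Printing Implicit Defensive.

Import Order.TTheory GRing.Theory Num.Theory.

Local Open Scope classical_set_scope.
Local Open Scope ring_scope.
Local Open Scope card_scope.

(* The norm of R[i] takes its values in R[i], so the real-valued modulus [abs]
   of the scalar field K is a parameter; it is meant to be instantiated with
   real_abs (K = R) or complex_abs (K = R[i]). *)
Definition real_abs (R : realType) (x : R) : R := `|x|.

Definition complex_abs (R : realType) (z : R[i]) : R := complex.Re `|z|.

Section EllOne.
Context {R : realType} {K : numFieldType} (abs : K -> R).

(* +oo exactly when f is not in ell_1 *)
Definition ell1_norm (f : nat -> K) : \bar R :=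
  (\sum_(0 <= n <oo) (abs (f n))%:E)%E.

Definition ell1 : set (nat -> K) := [set f | (ell1_norm f < +oo)%E].

Definition op_norm (T : (nat -> K) -> (nat -> K)) : \bar R :=
  ereal_sup [set ell1_norm (T f) | f in [set f | (ell1_norm f <= 1)%E]].

(* An operator on ell_1 is represented by a map on all scalar sequences; only
   its values on ell_1 are ever constrained or used. *)
Definition bounded_operator (T : (nat -> K) -> (nat -> K)) : Prop :=
  [/\ (forall f, ell1 f -> ell1 (T f)),
      (forall (a : K) f g, ell1 f -> ell1 g ->
         T (fun n => a * f n + g n) = (fun n => a * T f n + T g n)) &
      (op_norm T < +oo)%E].

Definition zero_diagonal (T : (nat -> K) -> (nat -> K)) : Prop :=
  forall n : nat, T \1_[set n] n = 0.

Definition restr (A : set nat) (f : nat -> K) : nat -> K :=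
  fun n => f n * \1_A n.

Definition Ros (T : (nat -> K) -> (nat -> K)) (eps : R) : set (set nat) :=
  [set A | infinite_set A /\
           (op_norm (restr A \o T \o restr A) <= eps%:E * op_norm T)%E].

Definition ros_family (G : set (set nat)) : Prop :=
  (forall A, G A -> infinite_set A) /\
  (forall T eps, bounded_operator T -> zero_diagonal T -> 0 < eps ->
     G `&` Ros T eps !=set0).

End EllOne.

Definition reaping_family (F : set (set nat)) : Prop :=
  (forall A, F A -> infinite_set A) /\
  ~ (exists S : set nat, forall A, F A ->
       infinite_set (A `&` S) /\ infinite_set (A `\` S)).

(* Cardinal numbers are represented by sets up to equipotence:
   [min_cardinality Phi k] says that the least cardinality of a family
   satisfying Phi exists, and that it is the cardinality of k. *)
Definition min_cardinality (Phi : set (set nat) -> Prop) (k : set (set nat))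
    : Prop :=
  (exists2 G, Phi G & G #= k) /\ (forall G, Phi G -> k #<= G).

Lemma min_cardinality_unique (Phi : set (set nat) -> Prop) k k' :
  min_cardinality Phi k -> min_cardinality Phi k' -> k #= k'.
Proof.
move=> [[G PG Gk] kmin] [[G' PG' Gk'] kmin'].
rewrite card_eq_le; apply/andP; split.
  by rewrite -(card_le_eqr Gk'); exact: kmin.
by rewrite -(card_le_eqr Gk); exact: kmin'.
Qed.

Definition is_ros_ell1 (R : realType) (K : numFieldType) (abs : K -> R)
    (k : set (set nat)) : Prop :=
  min_cardinality (ros_family abs) k.

Definition is_reaping_number (k : set (set nat)) : Prop :=
  min_cardinality reaping_family k.

(* Main.v *)
(* For [ros <= r]: a zero-diagonal matrix with bounded column sums admits, for
   every [k], a coloring of its indices with finitely many colors whose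
   monochromatic compressions have norm at most [2 / k] times the norm of the
   matrix (color greedily for the entries above and below the diagonal
   separately, then use compactness).  So it suffices to find, from a reaping
   family [F], a family of cardinality [#|F|] having a homogeneous member for
   every finite coloring; iterate reaping inside the members of [F], using
   [#|F| * #|F| = #|F|].

   For [r <= ros]: if no family of the size of [G] is reaping, then iterated
   splitting gives disjoint sets [P m] which all meet every member of [G] in an
   infinite set.  The operator sending the basis vector [n] to the basis vector
   [m] when [n] is in [P m] and [m < n] is not compressed by any member of [G]. *)
Require Import Defs.
From mathcomp Require Import all_boot all_order all_algebra.
From mathcomp Require Import all_classical all_reals all_analysis.
From mathcomp Require Import complex.
From mathcomp Require Import zify ring lra.

Set Implicit Arguments.
Unset Strict Implicit.
Unset Printing Implicit Defensive.

Import Order.TTheory GRing.Theory Num.Theory.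
Import numFieldNormedType.Exports.

Local Open Scope classical_set_scope.
Local Open Scope card_scope.

(** * Cardinal arithmetic *)

(* A maximal set [X] of choice functions with pairwise disjoint graphs projects
   onto some member [G] of [Phi], and injects into every member. *)
Lemma least_cardinality (T : pointedType) (Phi : set (set T)) :
  Phi !=set0 -> exists2 G, Phi G & forall H, Phi H -> G #<= H.
Proof.
move=> [H0 PhiH0].
pose P (X : set (set T -> T)) := forall x y, X x -> X y ->
  forall H, Phi H -> H (x H) /\ (x H = y H -> x = y).
have [X [PX Xmax]] : exists X, P X /\ forall B, X `<` B -> ~ P B.
  apply: Zorn_bigcup => F FP Ftot x y [X FX Xx] [Y FY Yy].
  have [XY|YX] := Ftot _ _ FX FY.
    by apply: (FP _ FY) => //; exact: XY.
  by apply: (FP _ FX) => //; exact: YX.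
have injX H : Phi H -> X #<= H.
  move=> PhiH; apply/pcard_leP/injfunPex; exists (fun x => x H).
    by move=> x Xx; have [] := PX x x Xx Xx H PhiH.
  move=> x y /set_mem Xx /set_mem Xy xy.
  by have [_] := PX x y Xx Xy H PhiH; apply.
have [G PhiG GX] : exists2 G, Phi G & G `<=` (fun x : set T -> T => x G) @` X.
  (* Otherwise a choice function that picks, in every member of [Phi], a point picked there by no
     element of [X] could be added to [X]. *)
  apply: contrapT => noG.
  have new H : exists z, Phi H -> H z /\ forall x, X x -> x H <> z.
    have [PhiH|nPhiH] := pselect (Phi H); last by exists point.
    have /existsNP[z /not_implyP[Hz zX]] :
        ~ (H `<=` (fun x : set T -> T => x H) @` X).
      by move=> HX; apply: noG; exists H.
    by exists z => _; split=> // x Xx xz; apply: zX; exists x.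
  have [z zP] := choice new.
  apply: (Xmax (X `|` [set z])).
    split; first by move=> x Xx; left.
    move=> /(_ z (or_intror erefl)) Xz.
    by have [_ /(_ z Xz)] := zP H0 PhiH0.
  move=> x y [Xx|->] [Xy|->] H PhiH.
  - exact: PX.
  - have [Hx _] := PX x x Xx Xx H PhiH; split=> // xz.
    by have [_ /(_ x Xx)] := zP H PhiH.
  - have [Hz zn] := zP H PhiH; split=> // zy.
    by case: (zn y Xy).
  - by have [Hz zn] := zP H PhiH.
exists G => // H PhiH; apply: card_le_trans (injX H PhiH).
by apply: card_le_trans (card_image_le (fun x => x G) X); exact: subset_card_le.
Qed.

Lemma card_le_total (T : pointedType) (A B : set T) : A #<= B \/ B #<= A.
Proof.
have [|G [->|->] Gmin] := @least_cardinality T [set A; B]; first by exists A; left.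
- by left; apply: Gmin; right.
- by right; apply: Gmin; left.
Qed.

(** * Squares of infinite sets *)

Section square.
Context {T : pointedType}.
Implicit Types (X Y : set T) (G : set (T * T * T)).

(** The domain is read off from the diagonal of the graph, so that Zorn's lemma applies to sets of
    triples under plain inclusion. *)
Definition pairing_dom G : set T := [set x | exists z, G (x, x, z)].

(* [G] is the graph of an injection of [Y * Y] into [Y], with
   [Y = pairing_dom G]. *)
Definition pairing G : Prop :=
  [/\ (forall x y z, G (x, y, z) ->
         [/\ pairing_dom G x, pairing_dom G y & pairing_dom G z]),
      (forall x y, pairing_dom G x -> pairing_dom G y ->
         exists z, G (x, y, z)) &
      (forall x y z x' y' z', G (x, y, z) -> G (x', y', z') ->
         z = z' <-> x = x' /\ y = y')].

Lemma pairing_bigcup (F : set (set (T * T * T))) :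
  F `<=` pairing -> total_on F subset -> pairing (\bigcup_(G in F) G).
Proof.
move=> FP Ftot.
have sub G : F G -> pairing_dom G `<=` pairing_dom (\bigcup_(G in F) G).
  by move=> FG x [z Gz]; exists z; exists G.
have join G H : F G -> F H -> exists K, [/\ F K, G `<=` K & H `<=` K].
  by move=> FG FH; have [GH|HG] := Ftot _ _ FG FH; [exists H|exists G]; split.
split.
- move=> x y z [G FG Gz]; have [+ _ _] := FP G FG.
  by move=> /(_ _ _ _ Gz)[Yx Yy Yz]; split; exact: (sub G FG).
- move=> x y [u [G FG Gu]] [v [H FH Hv]].
  have [K [FK GK HK]] := join G H FG FH.
  have [_ Ktot _] := FP K FK.
  have [||z Kz] := Ktot x y; [by exists u; exact: GK|by exists v; exact: HK|].
  by exists z; exists K.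
- move=> x y z x' y' z' [G FG Gz] [H FH Hz].
  have [K [FK GK HK]] := join G H FG FH.
  by have [_ _] := FP K FK; apply; [exact: GK|exact: HK].
Qed.

Lemma pairing_of_fun Y (f : T -> T -> T) :
  (forall x y, Y x -> Y y -> Y (f x y)) ->
  (forall x y x' y', Y x -> Y y -> Y x' -> Y y' ->
     f x y = f x' y' -> x = x' /\ y = y') ->
  pairing_dom [set t | [/\ Y t.1.1, Y t.1.2 & t.2 = f t.1.1 t.1.2]] = Y /\
  pairing [set t | [/\ Y t.1.1, Y t.1.2 & t.2 = f t.1.1 t.1.2]].
Proof.
move=> fY finj; set G := [set t | _].
have domG : pairing_dom G = Y.
  apply/seteqP; split=> [x [z []]//|x Yx].
  by exists (f x x).
split=> //; split; rewrite ?domG.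
- by move=> x y z [/= Yx Yy ->]; split=> //; exact: fY.
- by move=> x y Yx Yy; exists (f x y).
- move=> x y z x' y' z' [/= Yx Yy ->] [/= Yx' Yy' ->]; split=> [|[-> ->]//].
  exact: finj.
Qed.

Lemma pairing_fun G : pairing G -> exists f : T -> T -> T,
  [/\ forall x y, pairing_dom G x -> pairing_dom G y -> G (x, y, f x y),
    forall x y, pairing_dom G x -> pairing_dom G y -> pairing_dom G (f x y) &
    forall x y x' y', pairing_dom G x -> pairing_dom G y ->
      pairing_dom G x' -> pairing_dom G y' ->
     f x y = f x' y' -> x = x' /\ y = y'].
Proof.
move=> [Gdom Gtot Ginj].
have /choice[f fP] : forall xy : T * T, exists z,
    pairing_dom G xy.1 -> pairing_dom G xy.2 -> G (xy, z).
  move=> [x y] /=.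
  have [Yx|] := pselect (pairing_dom G x); last by exists point.
  have [Yy|] := pselect (pairing_dom G y); last by exists point.
  by have [z] := Gtot x y Yx Yy; exists z.
exists (fun x y => f (x, y)); split.
- by move=> x y Yx Yy; exact: fP.
- by move=> x y Yx Yy; have [] := Gdom _ _ _ (fP (x, y) Yx Yy).
- move=> x y x' y' Yx Yy Yx' Yy'.
  by have [] := Ginj _ _ _ _ _ _ (fP (x, y) Yx Yy) (fP (x', y') Yx' Yy').
Qed.

(* Hessenberg's theorem [X * X #= X].  A maximal injection [Y * Y -> Y] with
   [Y] infinite and included in [X] has [X `\` Y #<= Y]: otherwise a copy [Z] of
   [Y] in [X `\` Y] would absorb the three new blocks of [(Y `|` Z) ^ 2]. *)
Lemma infinite_pairing X : infinite_set X ->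
  exists2 f : T -> T -> T, (forall x y, X x -> X y -> X (f x y)) &
    forall x y x' y', X x -> X y -> X x' -> X y' ->
      f x y = f x' y' -> x = x' /\ y = y'.
Proof.
move=> /infiniteP/pcard_leP/injfunPex[i iX iinj].
have {}iinj m n : i m = i n -> m = n by apply: iinj; rewrite inE.
pose Y0 := range i.
have /choice[j jP] x : exists n, Y0 x -> i n = x.
  have [[n _ <-]|] := pselect (Y0 x); last by exists 0%N.
  by exists n.
have [||dom0 P0] := @pairing_of_fun Y0 (fun x y => i (pickle (j x, j y))).
- by move=> x y _ _; exists (pickle (j x, j y)).
- move=> x y x' y' Yx Yy Yx' Yy' /iinj/(pcan_inj pickleK)[jx jy].
  by rewrite -(jP _ Yx) -(jP _ Yy) -(jP _ Yx') -(jP _ Yy') jx jy.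
set G0 := (X in pairing X) in dom0 P0.
have G0i n : pairing_dom G0 (i n) by rewrite dom0; exists n.
pose P G := [/\ pairing G, pairing_dom G `<=` X & G = set0 \/ G0 `<=` G].
have [G [[PG GX GG0] Gmax]] : exists G, P G /\ forall B, G `<` B -> ~ P B.
  apply: Zorn_bigcup => F FP Ftot; split.
  - by apply: pairing_bigcup => // K /FP[].
  - by move=> x [z [K FK Kz]]; have [_ KX _] := FP K FK; apply: KX; exists z.
  - have [[H FH H0]|all0] := pselect (exists2 H, F H & H <> set0).
      have [_ _ [//|G0H]] := FP H FH.
      by right=> t G0t; exists H => //; exact: G0H.
    left; apply/seteqP; split=> // t [H FH Ht].
    by case: all0; exists H => // H0; rewrite H0 in Ht.
have {}GG0 : G0 `<=` G.
  case: GG0 => // GE; exfalso; apply: (Gmax G0).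
    by split; rewrite GE // => G0sub; have [z /G0sub] := G0i 0%N.
  by split=> //; [rewrite dom0 => _ [n _ <-]; exact: iX|right].
have Yi n : pairing_dom G (i n) by have [z /GG0] := G0i n; exists z.
have [f [fG fY finj]] := pairing_fun PG.
set Y := pairing_dom G in GX Yi fG fY finj.
have [|] := card_le_total (X `\` Y) Y => /pcard_leP/injfunPex[g gY ginj].
  (* The tags [i 0] and [i 1] separate [Y] from the rest of [X], so [h] embeds [X] into [Y] and [f]
     can be pulled back along it. *)
  pose h x := if x \in Y then f (i 0%N) x else f (i 1%N) (g x).
  have hY x : X x -> Y (h x).
    move=> Xx; rewrite /h; case: ifPn => [/set_mem Yx|/negP nYx].
      exact: fY.
    by apply: fY => //; apply: gY; split=> // Yx; apply: nYx; rewrite inE.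
  have hinj x y : X x -> X y -> h x = h y -> x = y.
    move=> Xx Xy; rewrite /h.
    have gD z : X z -> z \notin Y -> (X `\` Y) z by move=> Xz; rewrite notin_setE.
    case: ifPn => [/set_mem Yx|nYx]; case: ifPn => [/set_mem Yy|nYy].
    - by move=> /finj[].
    - by move=> /finj[]//; [exact: gY (gD _ Xy nYy)|move=> /iinj].
    - by move=> /finj[]//; [exact: gY (gD _ Xx nYx)|move=> /iinj].
    - move=> /finj[]//; [exact: gY (gD _ Xx nYx)|exact: gY (gD _ Xy nYy)|].
      by move=> _; apply: ginj; rewrite inE; exact: gD.
  exists (fun x y => f (h x) (h y)).
    by move=> x y Xx Xy; apply/GX/fY; exact: hY.
  move=> x y x' y' Xx Xy Xx' Xy' /finj[]; try exact: hY.
  by move=> /hinj-> // /hinj->.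
exfalso; pose Z := g @` Y.
have ZD z : Z z -> X z /\ ~ Y z by move=> [y Yy <-]; exact: gY.
have /choice[r rP] x : exists y, (Y `|` Z) x -> Y y /\ x = if x \in Y then y else g y.
  have [Yx|nYx] := boolP (x \in Y); first by exists x => _; rewrite inE in Yx.
  have [Zx|nZx] := pselect (Z x); last first.
    by exists point => -[Yx|//]; rewrite notin_setE in nYx.
  by have [y Yy <-] := Zx; exists y.
(* [F] extends [f]. The three other blocks are sent into [Z], with tag 0 for Z x Z, 1 for Y x Z and
   2 for Z x Y; [r] replaces each point by its representative in [Y]. *)
pose F x y := if (x \in Y) && (y \in Y) then f x y else
  g (f (i ((x \in Y) + (y \in Y).*2)%N) (f (r x) (r y))).
have rY x : (Y `|` Z) x -> Y (r x) by move=> /rP[].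
have [||domW PW] := @pairing_of_fun (Y `|` Z) F.
- move=> x y Wx Wy; rewrite /F; case: ifPn => [/andP[/set_mem Yx /set_mem Yy]|_].
    by left; exact: fY.
  right; exists (f (i ((x \in Y) + (y \in Y).*2)%N) (f (r x) (r y))) => //.
  by apply: (fY) => //; apply: fY; exact: rY.
- move=> x y x' y' Wx Wy Wx' Wy'; rewrite /F.
  have Yff a b b' : (Y `|` Z) b -> (Y `|` Z) b' -> Y (f (i a) (f (r b) (r b'))).
    by move=> Wb Wb'; apply: (fY) => //; apply: fY; exact: rY.
  case: ifPn => [/andP[/set_mem Yx /set_mem Yy]|_];
    case: ifPn => [/andP[/set_mem Yx' /set_mem Yy']|_].
  + by move=> /finj[].
  + move=> E; have Zf : Z (f x y) by rewrite E; eexists; last reflexivity; exact: Yff.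
    by have [_ []] := ZD _ Zf; exact: fY.
  + move=> E; have Zf : Z (f x' y') by rewrite -E; eexists; last reflexivity; exact: Yff.
    by have [_ []] := ZD _ Zf; exact: fY.
  + move=> /ginj; rewrite !inE => /(_ (Yff _ _ _ Wx Wy) (Yff _ _ _ Wx' Wy')).
    move=> /finj[]; try (by [|apply: fY; exact: rY]).
    move=> /iinj tagE /finj[]; try exact: rY.
    move=> rx ry; have [xY yY] : (x \in Y) = (x' \in Y) /\ (y \in Y) = (y' \in Y).
      by move: tagE; do 4 case: (_ \in Y).
    have [_ xE] := rP x Wx; have [_ yE] := rP y Wy.
    have [_ xE'] := rP x' Wx'; have [_ yE'] := rP y' Wy'.
    by split; [rewrite [LHS]xE [RHS]xE' xY rx|rewrite [LHS]yE [RHS]yE' yY ry].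
have GW : G `<=` [set t | [/\ (Y `|` Z) t.1.1, (Y `|` Z) t.1.2
                           & t.2 = F t.1.1 t.1.2]].
  move=> [[x y] z] Gz; have [Gdom _ Ginj] := PG.
  have [Yx Yy _] := Gdom _ _ _ Gz; split=> /=; [by left|by left|].
  rewrite /F !mem_set //=.
  by have [_] := Ginj _ _ _ _ _ _ Gz (fG x y Yx Yy); apply.
set W := (W in G `<=` W) in domW PW GW.
apply: (Gmax W).
- split=> // WG; have Zg : Z (g (i 0%N)) by exists (i 0%N).
  have [_] := ZD _ Zg; apply.
  have : pairing_dom W (g (i 0%N)) by rewrite domW; right; exists (i 0%N).
  by move=> [z /WG Gz]; exists z.
- split=> //; first by rewrite domW => x [/GX//|/ZD[]].
  by right; exact: subset_trans GW.
Qed.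

Lemma card_setX_infinite (U V : Type) X (A : set U) (B : set V) :
  infinite_set X -> A #<= X -> B #<= X -> A `*` B #<= X.
Proof.
move=> /infinite_pairing[f fX finj] /pcard_leP/injfunPex[a aX ainj].
move=> /pcard_leP/injfunPex[b bX binj].
apply/pcard_leP/injfunPex; exists (fun t => f (a t.1) (b t.2)).
  by move=> [u v] [/= Au Bv]; apply: fX; [exact: aX|exact: bX].
move=> [u v] [u' v'] /set_mem[/= Au Bv] /set_mem[/= Au' Bv'].
move=> /finj[]; [exact: aX|exact: bX|exact: aX|exact: bX|].
by move=> aE bE; congr (_, _); [apply: ainj|apply: binj]; rewrite ?inE.
Qed.

Lemma card_seq_infinite (U : choiceType) X (A : set U) :
  infinite_set X -> A #<= X -> [set s : seq U | {in s, forall u, A u}] #<= X.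
Proof.
move=> infX /pcard_leP/injfunPex[a aX ainj].
have [f fX finj] := infinite_pairing infX.
have /infiniteP/pcard_leP/injfunPex[i iX iinj] := infX.
have {}iinj m n : i m = i n -> m = n by apply: iinj; rewrite inE.
pose code := foldr (fun u x => f (a u) x) (i 0%N).
have codeX (s : seq U) : {in s, forall u, A u} -> X (code s).
  elim: s => [|u s IHs] As /=; first exact: iX.
  apply: fX; first by apply/aX/As; rewrite mem_head.
  by apply: IHs => v vs; apply: As; rewrite in_cons vs orbT.
(* The length is stored as well, since [code] alone might identify sequences of different
   lengths. *)
apply/pcard_leP/injfunPex; exists (fun s => f (i (size s)) (code s)).
  by move=> s As; apply: fX; [exact: iX|exact: codeX].
move=> s t /set_mem As /set_mem At /finj[||||/iinj]; try exact: iX.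
- exact: codeX.
- exact: codeX.
elim: s t As At => [|u s IHs] [|v t] //= As At [st] /finj[||||].
- by apply/aX/As; rewrite mem_head.
- by apply: codeX => w ws; apply: As; rewrite in_cons ws orbT.
- by apply/aX/At; rewrite mem_head.
- by apply: codeX => w ws; apply: At; rewrite in_cons ws orbT.
move=> aE cE; congr (_ :: _).
  by apply: ainj; rewrite ?inE //; [apply: As|apply: At]; rewrite mem_head.
apply: IHs => // w wst; [apply: As|apply: At]; by rewrite in_cons wst orbT.
Qed.

End square.

(** * Reaping families *)

Lemma infinite_natP (A : set nat) :
  infinite_set A <-> forall n, exists2 m, A m & (n <= m)%N.
Proof.
split=> [infA n|cofA /finite_seqP[s sA]].
  apply: contrapT => noA; apply/infA/(sub_finite_set _ (finite_II n)) => m Am /=.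
  by rewrite ltnNge; apply/negP => nm; apply: noA; exists m.
have [m Am] := cofA (\max_(i <- s) i).+1; rewrite ltnNge => /negP; apply.
by apply: leq_bigmax_seq => //; rewrite sA in Am.
Qed.

Lemma infinite_nat_enum (A : set nat) : infinite_set A ->
  exists2 e : nat -> nat, injective e & range e `<=` A.
Proof.
move=> /infiniteP/pcard_leP/injfunPex[e eA einj]; exists e.
  by move=> m n; apply: einj; rewrite inE.
by move=> _ [n _ <-]; exact: eA.
Qed.

Lemma infinite_image_inj (e : nat -> nat) (A : set nat) :
  injective e -> infinite_set A -> infinite_set (e @` A).
Proof.
move=> einj infA; have /card_eqPle[_ Ae] : e @` A #= A.
  by apply: inj_card_eq => m n _ _; exact: einj.
by move=> /(card_le_finite Ae).
Qed.

(* Along a sequence visiting each [E i] infinitely often, choose distinct points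
   [a k] and put every other one of them in the splitting set. *)
Lemma countable_split (E : nat -> set nat) :
  (forall i, infinite_set (E i)) -> exists S : set nat, forall i,
    infinite_set (E i `&` S) /\ infinite_set (E i `\` S).
Proof.
move=> infE.
have /choice[p pP] (x : nat * nat) : exists m, E x.1 m /\ (x.2 <= m)%N.
  by have [m Em xm] := (infinite_natP _).1 (infE x.1) x.2; exists m.
(* [k] codes the number of a set, a counter that makes every pair recur infinitely often, and a bit
   deciding whether the chosen point enters the splitting set. *)
pose index k : nat * bool := if @unpickle (nat * nat * bool)%type k is Some (i, _, b)
  then (i, b) else (0%N, true).
pose a := fix a k := if k is k'.+1 then p ((index k).1, (a k').+1) else p ((index 0%N).1, 0%N).
have aE k : E (index k).1 (a k) by case: k => [|k]; [have [] := pP ((index 0%N).1, 0%N)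
                         |have [] := pP ((index k.+1).1, (a k).+1)].
have a_incr k : (a k < a k.+1)%N by have [] := pP ((index k.+1).1, (a k).+1).
have a_mono : {homo a : m n / (m < n)%N} by apply: homo_ltn => //; exact: ltn_trans.
have a_inj : injective a.
  move=> m n amn; case: (ltngtP m n) => // /a_mono; by rewrite amn ltnn.
have a_ge k : (k <= a k)%N.
  by elim: k => // k IHk; exact: leq_ltn_trans IHk (a_incr k).
have visit i b n : exists2 k, index k = (i, b) & (n <= k)%N.
  have pinj : injective (fun m : nat => pickle (i, m, b)).
    by move=> m m' /(pcan_inj pickleK)[].
  have := infinite_image_inj pinj infinite_nat.
  move=> /infinite_natP/(_ n)[_ [m _ <-] nk]; exists (pickle (i, m, b)) => //.
  by rewrite /index pickleK.
exists (a @` [set k | (index k).2]) => i; split; apply/infinite_natP => n.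
  have [k ki nk] := visit i true n; exists (a k); last exact: leq_trans (a_ge k).
  by split; [have := aE k; rewrite ki|exists k => //=; rewrite ki].
have [k ki nk] := visit i false n; exists (a k); last exact: leq_trans (a_ge k).
split; first by have := aE k; rewrite ki.
by move=> [k' /= k'1 /a_inj kk']; move: k'1; rewrite kk' ki.
Qed.

Lemma reaping_infinite (F : set (set nat)) : reaping_family F -> infinite_set F.
Proof.
move=> [Finf nosplit] /finite_set_countable/pcard_leP/injfunPex[c _ cinj].
apply: nosplit.
(* [E] lists [F] along the injection [c]; indices that code no member are filled with [setT], so
   that [countable_split] applies. *)
have /choice[E EP] i : exists A, infinite_set A /\ forall B, F B -> c B = i -> A = B.
  have [[A FA cA]|noA] := pselect (exists2 A, F A & c A = i); last first.
    by exists setT; split; [exact: infinite_nat|move=> B FB cB; case: noA; exists B].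
  exists A; split; first exact: Finf.
  by move=> B FB cB; apply: cinj; rewrite ?inE // cA.
have [S SP] := @countable_split E (fun i => (EP i).1).
by exists S => A FA; have [_ /(_ A FA erefl) <-] := EP (c A).
Qed.

(** The members of [G] are the images of nat under finite composites of injections into tails of
    members of [F]. They are indexed by finite sequences over [F] times nat, so there are at most as
    many as members of [F]. *)
Lemma reaping_homogeneous (F : set (set nat)) : reaping_family F ->
  exists G : set (set nat), [/\ forall A, G A -> infinite_set A, G #<= F &
    forall (C : finType) (c : nat -> C),
      exists A i, G A /\ forall n, A n -> c n = i].
Proof.
move=> RF; have infF := reaping_infinite RF; have [Finf nosplit] := RF.
(* A member of [F] not split by [S] is only almost included in [S] or in its complement; [x.2]
   serves to cut off the finite exception. *)
have /choice[e eP] (x : set nat * nat) : exists e : nat -> nat,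
    F x.1 -> injective e /\ range e `<=` x.1 `\` `I_(x.2).
  have [FA|] := pselect (F x.1); last by exists id.
  have [e einj eA] := infinite_nat_enum (infinite_setD (Finf _ FA) (finite_II x.2)).
  by exists e.
pose D := foldr (fun x B => e x @` B) [set: nat].
pose L := [set s : seq (set nat * nat) | {in s, forall x, (F `*` [set: nat]) x}].
have L_cons x s : L (x :: s) <-> F x.1 /\ L s.
  split=> [Lxs|[Fx Ls] y].
    split; first by have [] := Lxs x (mem_head _ _).
    by move=> y ys; apply: Lxs; rewrite in_cons ys orbT.
  by rewrite in_cons => /predU1P[->//|/Ls].
have Dinf s : L s -> infinite_set (D s).
  elim: s => [|x s IHs]; first by move=> _; exact: infinite_nat.
  move=> /L_cons[Fx Ls]; have [einj _] := eP x Fx.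
  exact: infinite_image_inj einj (IHs Ls).
exists (D @` L); split.
- by move=> _ [s Ls <-]; exact: Dinf.
- apply: card_le_trans (card_image_le _ _) _.
  apply: card_seq_infinite => //; apply: card_setX_infinite => //.
  exact/infiniteP.
move=> C c.
(* A tail of some [A] in [F] decides the first set of the list; the other sets are pulled back along
   the enumeration of that tail and decided by induction. *)
have hom (r : seq (set nat)) : exists2 s, L s &
    forall S, S \in r -> D s `<=` S \/ D s `<=` ~` S.
  have [n] := ubnP (size r); elim: n r => // n IHn [|S r] /= rn.
    by exists [::].
  have [[A n0] FA AS] : exists2 x, F x.1 &
      x.1 `\` `I_(x.2) `<=` S \/ x.1 `\` `I_(x.2) `<=` ~` S.
    have bnd B : finite_set B -> exists m, B `<=` `I_m.
      move=> finB; apply: contrapT => nbnd; apply: (_ : infinite_set B) finB.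
      apply/infinite_natP => m; apply: contrapT => noB; apply: nbnd.
      exists m => k Bk /=; rewrite ltnNge; apply/negP => mk.
      by apply: noB; exists k.
    have /existsNP[A /not_implyP[FA /not_andP[]]] :
        ~ forall A, F A -> infinite_set (A `&` S) /\ infinite_set (A `\` S).
    - by move=> split; apply: nosplit; exists S.
    - move=> /contrapT/bnd[m Am]; exists (A, m) => //=; right=> k [Ak km] Sk.
      by apply: km; exact: Am.
    - move=> /contrapT/bnd[m Am]; exists (A, m) => //=; left=> k [Ak km].
      by apply: contrapT => Sk; apply: km; exact: Am.
  set x := (A, n0) in FA AS; have [einj eA] := eP x FA.
  have [|s Ls sP] := IHn [seq e x @^-1` S' | S' <- r]; first by rewrite size_map.
  exists (x :: s); first exact/L_cons.
  move=> S'; rewrite in_cons => /predU1P[->|rS'].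
    by case: AS => AS; [left|right] => _ [k _ <-]; apply/AS/eA; exists k.
  by have [DS|DS] := sP _ (map_f _ rS'); [left|right] => _ [k Dk <-]; exact: DS.
(* Once all color classes are decided, [D s] must lie inside the class of any one of its points. *)
have [s Ls sP] := hom [seq c @^-1` [set i] | i <- enum C].
have [n0 Dn0] := infinite_setN0 (Dinf s Ls).
exists (D s), (c n0); split; first by exists s.
have [|DC n Dn|DC] := sP (c @^-1` [set c n0]).
- by apply/mapP; exists (c n0); rewrite ?mem_enum.
- exact: (DC n Dn).
- by case: (DC n0 Dn0).
Qed.

(* Splitting repeatedly yields disjoint sets [P k] each meeting every member of
   [G] in an infinite set; take [phi] constant equal to [k] on [P k]. *)
Lemma regressive_guess (G : set (set nat)) :
  (forall A, G A -> infinite_set A) ->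
  (forall H : set (set nat), H #<= G -> ~ reaping_family H) ->
  exists phi : nat -> nat, forall A, G A ->
    exists m n, [/\ A m, A n, (m < n)%N & phi n = m].
Proof.
move=> Ginf noreap.
(* The traces on [C] of the members of [G] form a family no larger than [G], hence not reaping. *)
have /choice[S SP] (C : set nat) : exists S : set nat,
    (forall A, G A -> infinite_set (A `&` C)) ->
    forall A, G A -> infinite_set (A `&` C `&` S) /\ infinite_set (A `&` C `\` S).
  have [infC|] := pselect (forall A, G A -> infinite_set (A `&` C)); last first.
    by exists set0.
  have := noreap _ (card_image_le (fun A => A `&` C) G).
  move=> /not_andP[[]|/contrapT[S SP]].
    by move=> _ [A GA <-]; exact: infC.
  by exists S => _ A GA; apply: SP; exists A.
(* [C k] is what remains after [k] splittings; the layers [C k] minus [S (C k)] are pairwise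
   disjoint because [C] decreases. *)
pose C := fix C k := if k is k'.+1 then C k' `&` S (C k') else setT.
have Cinf k A : G A -> infinite_set (A `&` C k).
  elim: k A => [|k IHk] A GA; first by rewrite setIT; exact: Ginf.
  by rewrite /= setIA; have [] := SP (C k) IHk A GA.
have Cdecr j k : (j <= k)%N -> C k `<=` C j.
  move=> /subnK <-; elim: (k - j)%N => // i IHi n [/= Cn _]; exact: IHi.
have /choice[phi phiP] n : exists m, forall k, C k n -> ~ S (C k) n -> m = k.
  have [[m [Cm Sm]]|no] := pselect (exists m, C m n /\ ~ S (C m) n); last first.
    by exists 0%N => k Ck Sk; case: no; exists k.
  exists m => k Ck Sk; case: (ltngtP m k) => // [mk|km].
    by case: Sm; have [] := Cdecr _ _ mk n Ck.
  by case: Sk; have [] := Cdecr _ _ km n Cm.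
(* Any [m] in [A] will do: layer number [m] meets [A] in an infinite set, hence beyond [m]. *)
exists phi => A GA; have [m Am] := infinite_setN0 (Ginf A GA).
have [_ /infinite_natP/(_ m.+1)[n [[An Cn] Sn] mn]] := SP (C m) (Cinf m) A GA.
by exists m, n; split=> //; exact: phiP.
Qed.

(** * Paving *)

Local Open Scope ring_scope.

(** Compactness: along an ultrafilter refining [\oo], each index settles on one of the finitely many
    colors, and finitely many indices can be treated at the same time. *)
Lemma coloring_limit (C : finType) (c_ : nat -> nat -> C) :
  exists c : nat -> C, forall M, exists2 N, (M <= N)%N &
    forall n, (n < M)%N -> c_ N n = c n.
Proof.
have [U [UU leU]] := @ultraFilterLemma nat \oo _.
have /choice[c cP] n : exists i, U [set N | c_ N n = i].
  apply: contrapT => noi.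
  have : U [set N | forall i, c_ N n <> i].
    apply: filter_forall => i; have [Ui|//] := in_ultra_setVsetC [set N | c_ N n = i] UU.
    by case: noi; exists i.
  by move=> /filter_ex[N /(_ (c_ N n))].
exists c => M.
have Uc : U [set N | forall i : 'I_M, c_ N i = c i].
  by apply: filter_forall => i; exact: cP.
have UM : U [set N | (M <= N)%N] by apply: leU; exact: nbhs_infty_ge.
have [N [cN MN]] := filter_ex (filterI Uc UM).
by exists N => // n nM; exact: (cN (Ordinal nM)).
Qed.

Section paving.
Context {R : realFieldType}.
Implicit Types (w : nat -> nat -> R) (t : R).

(** The color classes below [N] share the row sum of [N], so one of the [k.+1] colors carries at
    most the average; [N] receives that color. *)
Lemma greedy_coloring w t k N :
  (forall n, (n < N)%N -> \sum_(0 <= m < n) w n m <= t) ->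
  exists c : nat -> 'I_k.+1, forall n, (n < N)%N ->
    k.+1%:R * (\sum_(0 <= m < n | c m == c n) w n m) <= t.
Proof.
elim: N => [|N IHN] wt; first by exists (fun=> ord0).
have [c cP] := IHN (fun n nN => wt n (ltnW nN)).
have [i iP] : exists i, k.+1%:R * (\sum_(0 <= m < N | c m == i) w N m) <= t.
  apply: contrapT => noi.
  have : \sum_(i < k.+1) t < \sum_(i < k.+1) k.+1%:R * \sum_(0 <= m < N | c m == i) w N m.
    apply: ltr_sum => [|i _]; first by apply/hasP; exists ord0; rewrite ?mem_index_enum.
    by rewrite ltNge; apply/negP => it; apply: noi; exists i.
  rewrite -mulr_sumr sumr_const card_ord -[t *+ _]mulr_natl ltr_pM2l ?ltr0n //.
  rewrite (exchange_big_dep predT) //= ltNge => /negP; apply.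
  apply: le_trans (wt N (ltnSn N)); apply: ler_sum => m _.
  by rewrite (big_pred1 (c m)) // => i; rewrite eq_sym.
exists (fun x => if x == N then i else c x) => n; rewrite ltnS leq_eqVlt.
have E x y : (y < x)%N -> y != x by move=> yx; rewrite ltn_eqF.
case: eqVneq => [->|nN] /= nltN; rewrite big_nat_cond.
  rewrite (eq_bigl (fun m => (0 <= m < N)%N && (c m == i))) -?big_nat_cond // => m.
  by rewrite leq0n /=; case: ltnP => //= /E/negbTE->.
rewrite (eq_bigl (fun m => (0 <= m < n)%N && (c m == c n))) -?big_nat_cond.
  exact: cP.
move=> m; rewrite leq0n /=; case: ltnP => //= mn.
by rewrite (negbTE (E _ _ (ltn_trans mn nltN))).
Qed.

(* A greedy coloring controls the earlier entries of each row, and a greedy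
   coloring in the reverse order controls the later ones. *)
Lemma finite_paving w t k N :
  (forall n m, 0 <= w n m) -> (forall n M, \sum_(0 <= m < M) w n m <= t) ->
  exists c : nat -> 'I_k.+1 * 'I_k.+1, forall n, (n < N)%N ->
    k.+1%:R * (\sum_(0 <= m < N | (c m == c n) && (m != n)) w n m) <= 2 * t.
Proof.
move=> w0 wt.
have [n _|c1 c1P] := @greedy_coloring w t k N; first exact: wt.
(* Order reversal on the indices below [N]; it is an involution only there, because subtraction is
   truncated. *)
pose rev n := (N - n.+1)%N.
have revK n : (n < N)%N -> rev (rev n) = n by rewrite /rev; lia.
have [n nN|c2 c2P] := @greedy_coloring (fun n m => w (rev n) (rev m)) t k N.
  rewrite (big_nat_widen _ _ N) ?(ltnW nN) // big_nat_rev /= add0n.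
  apply: le_trans (wt (rev n) N); rewrite [leRHS](bigID (fun m => (rev m < n)%N)) /=.
  rewrite big_nat_cond [X in _ <= X + _]big_nat_cond ler_wpDr ?sumr_ge0 //.
  by apply: ler_sum => m /andP[/andP[_ mN] _]; rewrite -/(rev m) revK.
exists (fun n => (c1 n, c2 (rev n))) => n nN.
rewrite mulr2n mulrDl !mul1r.
have rN : (rev n < N)%N by rewrite /rev; lia.
apply: le_trans (lerD (c1P n nN) (c2P (rev n) rN)).
rewrite -mulrDr ler_pM2l ?ltr0n // (big_nat_widen 0 n N) ?(ltnW nN) //.
rewrite (big_nat_widen 0 (rev n) N) ?(ltnW rN) // [X in _ <= _ + X]big_nat_rev /= add0n.
rewrite [X in _ <= X + _]big_mkcond [X in _ <= _ + X]big_mkcond -big_split /=.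
rewrite [leLHS]big_mkcond /= big_nat_cond [leRHS]big_nat_cond.
apply: ler_sum => m /andP[/andP[_ mN] _]; rewrite -/(rev m) !revK //.
have -> : (rev m < rev n)%N = (n < m)%N by rewrite /rev; lia.
rewrite xpair_eqE; have := w0 n m.
by case: (c1 m == _); case: (c2 _ == _); case: ltngtP; rewrite /= ?addr0 ?add0r.
Qed.

(** A given sum involves finitely many indices, on which the limit coloring agrees with one of the
    finite colorings. *)
Lemma paving w t k :
  (forall n m, 0 <= w n m) -> (forall n M, \sum_(0 <= m < M) w n m <= t) ->
  exists c : nat -> 'I_k.+1 * 'I_k.+1, forall n M,
    k.+1%:R * (\sum_(0 <= m < M | (c m == c n) && (m != n)) w n m) <= 2 * t.
Proof.
move=> w0 wt; have /choice[c_ c_P] N := @finite_paving w t k N w0 wt.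
have [c cP] := coloring_limit c_; exists c => n M.
have [N] := cP (maxn M n.+1); rewrite geq_max => /andP[MN nN] cN.
apply: le_trans (c_P N n nN); rewrite ler_pM2l ?ltr0n //.
rewrite (big_nat_widen 0 M N) // [leLHS]big_mkcond [leRHS]big_mkcond /=.
apply: ler_sum => m _; case: (ltnP m M) => mM; rewrite ?andbT ?andbF.
  by rewrite !cN // leq_max ?mM ?ltnSn ?orbT.
by case: ifP.
Qed.

End paving.

(** * Operators on ell_1 *)

(** What [real_abs] and [complex_abs] have in common; it allows both scalar fields to be treated at
    once. *)
Record modulus (R : realType) (K : numFieldType) (abs : K -> R) : Prop := Modulus {
  modulus_ge0 : forall x, 0 <= abs x;
  modulusD : forall x y, abs (x + y) <= abs x + abs y;
  modulusM : forall x y, abs (x * y) = abs x * abs y;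
  modulus_nat : forall n, abs n%:R = n%:R }.

(* [L] stands for [f |-> \sum_n f n], which has no total version in an abstract
   [numFieldType]. *)
Record summation (R : realType) (K : numFieldType) (abs : K -> R)
    (L : (nat -> K) -> K) (C : R) : Prop := Summation {
  summation_lin : forall a f g, ell1 abs f -> ell1 abs g ->
    L (fun n => a * f n + g n) = a * L f + L g;
  summation_bound : forall f, ell1 abs f ->
    ((abs (L f))%:E <= C%:E * ell1_norm abs f)%E;
  summation_indic : forall n, L \1_[set n] = 1 }.

Section operators.
Context {R : realType} {K : numFieldType} {abs : K -> R}.
Hypothesis absP : modulus abs.
Implicit Types (f g h : nat -> K) (T : (nat -> K) -> (nat -> K)).

Local Notation norm := (ell1_norm abs).

Let abs_ge0 := modulus_ge0 absP.
Let absM := modulusM absP.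

Let abs0 : abs 0 = 0. Proof. exact: (modulus_nat absP 0). Qed.
Let abs1 : abs 1 = 1. Proof. exact: (modulus_nat absP 1). Qed.

Lemma modulus_sum (I : Type) (r : seq I) (F : I -> K) :
  abs (\sum_(i <- r) F i) <= \sum_(i <- r) abs (F i).
Proof.
apply: (big_ind2 (fun x a => abs x <= a)) => [|x a y b xa yb|//]; first by rewrite abs0.
by apply: le_trans (modulusD absP x y) _; exact: lerD.
Qed.

Lemma ell1_norm_ge0 f : (0 <= norm f)%E.
Proof. by apply: nneseries_ge0 => n _ _; rewrite lee_fin. Qed.

Lemma ell1_norm_leP f (r : R) :
  (norm f <= r%:E)%E <-> forall M, \sum_(0 <= n < M) abs (f n) <= r.
Proof.
split=> [fr M|fr].
  rewrite -lee_fin -sumEFin; apply: le_trans fr.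
  by apply: nneseries_lim_ge => n _ _; rewrite lee_fin.
apply: lime_le; first by apply: is_cvg_nneseries => n _ _; rewrite lee_fin.
by apply: nearW => M; rewrite sumEFin lee_fin.
Qed.

Lemma ell1P f : ell1 abs f <-> exists r : R, (norm f <= r%:E)%E.
Proof.
split=> [fy|[r fr]]; last exact: le_lt_trans fr (ltry r).
by exists (fine (norm f)); rewrite fineK // ge0_fin_numE // ell1_norm_ge0.
Qed.

Lemma ell1_norm_mono f g :
  (forall n, abs (f n) <= abs (g n)) -> (norm f <= norm g)%E.
Proof. by move=> fg; apply: lee_nneseries => n _; rewrite ?lee_fin. Qed.

Lemma ell1_mono f g :
  (forall n, abs (f n) <= abs (g n)) -> ell1 abs g -> ell1 abs f.
Proof. by move=> /ell1_norm_mono; exact: le_lt_trans. Qed.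

Lemma ell1_norm_indic n : (norm \1_[set n] <= 1%:E)%E.
Proof.
apply/ell1_norm_leP => M; rewrite [leLHS](_ : _ = (n < M)%:R :> R).
  by case: (n < M)%N; rewrite ?ler01.
elim: M => [|M IHM]; first by rewrite big_geq.
rewrite big_nat_recr //= IHM indicE [in RHS]ltnS [in RHS]leq_eqVlt.
case: (eqVneq n M) => [->|nM] /=; rewrite ?ltnn.
  by rewrite mem_set //= abs1 add0r.
by rewrite memNset ?abs0 ?addr0 //= => Mn; rewrite Mn eqxx in nM.
Qed.

Lemma ell1_indic n : ell1 abs \1_[set n].
Proof. by apply/ell1P; exists 1; exact: ell1_norm_indic. Qed.

Lemma ell1_cst0 : ell1 abs (fun=> 0).
Proof. by apply: (ell1_mono _ (ell1_indic 0)) => n; rewrite abs0. Qed.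

Lemma op_norm_ge0 T : (0 <= op_norm abs T)%E.
Proof.
apply: le_trans (ell1_norm_ge0 (T \1_[set 0%N])) _.
by apply: ereal_sup_ubound; exists \1_[set 0%N] => //; exact: ell1_norm_indic.
Qed.

(** [N] is chosen so that its partial sum comes within [e] of the supremum of all partial sums. *)
Lemma ell1_tail f (e : R) : ell1 abs f -> 0 < e ->
  exists N, (norm (fun n => (if (n < N)%N then 0 else f n)%R) <= e%:E)%E.
Proof.
move=> /ell1P[r /ell1_norm_leP fr] e0.
pose S := [set \sum_(0 <= n < M) abs (f n) | M in [set: nat]].
have supS : has_sup S.
  by split; [exists (\sum_(0 <= n < 0) abs (f n)); exists 0%N|exists r => _ [M _ <-]].
have [_ [N _ <-] supN] := sup_adherent e0 supS.
exists N; apply/ell1_norm_leP => M.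
apply: (@le_trans _ _ (sup S - \sum_(0 <= n < N) abs (f n))); last lra.
rewrite lerBrDr; apply: (@le_trans _ _ (\sum_(0 <= n < maxn M N) abs (f n))); last first.
  by apply: ub_le_sup; [exact: supS.2|exists (maxn M N)].
rewrite (big_nat_widen 0 M (maxn M N)) ?leq_maxl //.
rewrite (big_nat_widen 0 N (maxn M N)) ?leq_maxr //.
rewrite big_mkcond [X in _ + X]big_mkcond -big_split /=; apply: ler_sum => n _.
case: (n < N)%N; first by rewrite abs0; case: ifP; rewrite add0r.
by case: ifP; rewrite addr0.
Qed.

Section bounded.
Variable T : (nat -> K) -> (nat -> K).
Hypothesis Tbd : bounded_operator abs T.
Let t := fine (op_norm abs T).

Let op_normE : op_norm abs T = t%:E.
Proof. by rewrite fineK // ge0_fin_numE ?op_norm_ge0 //; case: Tbd. Qed.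

Let T_lin a f g : ell1 abs f -> ell1 abs g ->
  T (fun n => a * f n + g n) = (fun n => a * T f n + T g n).
Proof. by case: Tbd => _ + _; exact. Qed.

Let T0 : T (fun=> 0) = fun=> 0.
Proof.
have := T_lin 1 ell1_cst0 ell1_cst0.
rewrite (_ : (fun n => _) = fun=> 0) => [TE|]; last first.
  by apply/funext => n; rewrite mulr0 addr0.
apply/funext => n; have := congr1 (fun f => f n) TE.
by rewrite mul1r => /eqP; rewrite -subr_eq subrr => /eqP.
Qed.

(** [op_norm] only tests the unit ball, and natural numbers are the scalars of [K] whose modulus is
    prescribed; so [h] is scaled up by [j.+1]. *)
Lemma bounded_operator_scale h (j : nat) : (norm h <= j.+1%:R^-1%:E)%E ->
  (norm (T h) <= (t / j.+1%:R)%:E)%E.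
Proof.
move=> hj; have h1 : ell1 abs h by apply/ell1P; eexists; exact: hj.
have Th := T_lin j.+1%:R h1 ell1_cst0.
have normh : (norm (fun n => (j.+1%:R * h n + 0)%R) <= 1%:E)%E.
  apply/ell1_norm_leP => M; under eq_bigr do rewrite addr0 absM (modulus_nat absP).
  rewrite -mulr_sumr -ler_pdivlMl ?ltr0n // mulr1.
  by move/ell1_norm_leP: hj.
have : (norm (T (fun n => (j.+1%:R * h n + 0)%R)) <= t%:E)%E.
  by rewrite -op_normE; apply: ereal_sup_ubound; eexists; first exact: normh.
rewrite Th T0 => /ell1_norm_leP jT; apply/ell1_norm_leP => M.
have := jT M; under eq_bigr do rewrite addr0 absM (modulus_nat absP).
by rewrite -mulr_sumr ler_pdivlMr ?ltr0n // mulrC.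
Qed.

Lemma bounded_operator_trunc f N :
  T (fun n => if (n < N)%N then f n else 0) =
  fun m => \sum_(0 <= n < N) f n * T \1_[set n] m.
Proof.
elim: N => [|N IHN] /=.
  by rewrite T0; apply/funext => m; rewrite big_geq.
have fN : ell1 abs (fun n => if (n < N)%N then f n else 0).
  apply/ell1P; exists (\sum_(0 <= n < N) abs (f n)); apply/ell1_norm_leP => M.
  rewrite (big_nat_widen 0 M (maxn M N)) ?leq_maxl //.
  rewrite (big_nat_widen 0 N (maxn M N)) ?leq_maxr //.
  rewrite [leLHS]big_mkcond [leRHS]big_mkcond /=.
  by apply: ler_sum => n _; do 2 case: ifP; rewrite ?abs0.
rewrite (_ : (fun n => _) =
    fun n => f N * \1_[set N] n + (if (n < N)%N then f n else 0)); last first.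
  apply/funext => n; rewrite indicE ltnS leq_eqVlt.
  case: (eqVneq n N) => [->|nN] /=; first by rewrite mem_set //= mulr1 ltnn addr0.
  by rewrite memNset ?mulr0 ?add0r //= => nN'; rewrite nN' eqxx in nN.
rewrite T_lin //; last exact: ell1_indic.
by apply/funext => m; rewrite IHN big_nat_recr //= addrC.
Qed.

(** On [ell1] the columns control the norm. Linearity only reaches finite sums, so the tail of the
    argument is bounded through [T] itself, at the cost of [t * e]. *)
Lemma op_norm_restr (A : set nat) (d e : R) : 0 <= d -> 0 < e ->
  (forall n, A n -> forall M, \sum_(0 <= m < M | m \in A) abs (T \1_[set n] m) <= d) ->
  (op_norm abs (restr A \o T \o restr A) <= (d + t * e)%:E)%E.
Proof.
move=> d0 e0 colA; apply: ge_ereal_sup => _ [f f1 <-]; apply/ell1_norm_leP => M.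
set g := restr A f; rewrite /comp -/g.
pose j := Num.bound e^-1.
have je : j.+1%:R^-1 <= e.
  rewrite invf_ple ?posrE ?ltr0n //; apply/ltW/(lt_trans (archi_boundP _)).
    by rewrite invr_ge0 ltW.
  by rewrite ltr_nat.
have gf n : abs (g n) <= abs (f n).
  by rewrite /g /restr absM indicE; case: (n \in A); rewrite ?abs1 ?abs0 ?mulr1 ?mulr0.
have g1 := le_trans (ell1_norm_mono gf) f1.
have ellg : ell1 abs g by apply/ell1P; exists 1.
have [N tailN] : exists N,
    (norm (fun n => (if (n < N)%N then 0 else g n)%R) <= j.+1%:R^-1%:E)%E.
  by apply: ell1_tail => //; rewrite invr_gt0 ltr0n.
set g2 := (fun n => _) in tailN.
pose g' n := if (n < N)%N then g n else 0.
have Tg : T g = fun m => \sum_(0 <= n < N) g n * T \1_[set n] m + T g2 m.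
  have gE : g = fun n => 1 * g' n + g2 n.
    by apply/funext => n; rewrite mul1r /g' /g2; case: ifP; rewrite ?addr0 ?add0r.
  rewrite {1}gE T_lin ?bounded_operator_trunc.
  - by apply/funext => m; rewrite mul1r.
  - by apply: ell1_mono ellg => n; rewrite /g'; case: ifP; rewrite ?abs0.
  - by apply: ell1_mono ellg => n; rewrite /g2; case: ifP; rewrite ?abs0.
apply: (@le_trans _ _ (\sum_(0 <= m < M | m \in A)
    (\sum_(0 <= n < N) abs (g n) * abs (T \1_[set n] m) + abs (T g2 m)))).
  rewrite [leRHS]big_mkcond; apply: ler_sum => m _.
  rewrite /restr indicE; case: (m \in A); last by rewrite mulr0 abs0.
  rewrite mulr1 -/g Tg; apply: le_trans (modulusD absP _ _) _; rewrite lerD2r.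
  by apply: le_trans (modulus_sum _ _) _; apply: ler_sum => n _; rewrite absM.
rewrite big_split /=; apply: lerD; last first.
  apply: (@le_trans _ _ (t / j.+1%:R)).
    move/ell1_norm_leP: (bounded_operator_scale tailN) => /(_ M); apply: le_trans.
    by rewrite big_mkcond; apply: ler_sum => m _; case: ifP.
  by rewrite ler_wpM2l // -lee_fin -op_normE op_norm_ge0.
rewrite exchange_big /=; apply: (@le_trans _ _ (\sum_(0 <= n < N) abs (g n) * d)).
  apply: ler_sum => n _; rewrite -mulr_sumr.
  have [An|nA] := boolP (n \in A); first by rewrite ler_wpM2l // colA // -inE.
  by rewrite /g /restr indicE (negbTE nA) mulr0 abs0 !mul0r.
rewrite -mulr_suml -[leRHS]mul1r ler_wpM2r //.
by move/ell1_norm_leP: g1.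
Qed.

End bounded.
End operators.

(** * The two inequalities *)

Section ros.
Context {R : realType} {K : numFieldType} {abs : K -> R}.
Hypothesis absP : modulus abs.

Lemma homogeneous_ros (G : set (set nat)) :
  (forall A, G A -> infinite_set A) ->
  (forall (C : finType) (c : nat -> C),
     exists A i, G A /\ forall n, A n -> c n = i) ->
  ros_family abs G.
Proof.
move=> Ginf Ghom; split=> // T e Tbd Tdiag e0.
have Ty : (op_norm abs T < +oo)%E by case: Tbd.
pose t := fine (op_norm abs T).
have tE : op_norm abs T = t%:E by rewrite fineK // ge0_fin_numE ?op_norm_ge0.
have t0 : 0 <= t by rewrite -lee_fin -tE op_norm_ge0.
have colT n M : \sum_(0 <= m < M) abs (T \1_[set n] m) <= t.
  apply: (ell1_norm_leP absP _ _).1; rewrite -tE; apply: ereal_sup_ubound.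
  by exists \1_[set n] => //; exact: ell1_norm_indic.
(* This makes the paving bound [2 * t / k.+1] at most [e / 2 * t]; the other half of [e * t] is left
   for the tail in [op_norm_restr]. *)
pose k := Num.bound (4 / e).
have ke : 4 < e * k.+1%:R.
  rewrite mulrC -ltr_pdivrMr //; apply: lt_trans (archi_boundP _) _.
    by rewrite divr_ge0 // ltW.
  by rewrite ltr_nat.
have [c cP] := paving k (fun n m => modulus_ge0 absP (T \1_[set n] m)) colT.
have [A [i [GA Ai]]] := Ghom _ c.
exists A; split=> //; split; first exact: Ginf.
rewrite tE -EFinM (_ : e * t = e / 2 * t + t * (e / 2)); last lra.
apply: op_norm_restr; rewrite ?divr_gt0 //.
  by rewrite mulr_ge0 // divr_ge0 // ltW.
move=> n An M; have := cP n M; set s := (X in _ * X <= _) => sP.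
apply: (@le_trans _ _ s).
  rewrite /s big_mkcond [leRHS]big_mkcond; apply: ler_sum => m _.
  case: ifPn => [/set_mem Am|_]; last by case: ifP => // _; exact: modulus_ge0.
  (* The paving leaves out the diagonal entry, which vanishes by [Tdiag]. *)
  by rewrite !Ai // eqxx /=; case: eqVneq => [->|//]; rewrite Tdiag (modulus_nat absP 0).
rewrite -(@ler_pM2l _ k.+1%:R) ?ltr0n //; apply: le_trans sP _.
by rewrite mulrA ler_wpM2r // mulrC; lra.
Qed.

(* The operator sending the basis vector [n] to the basis vector [phi n] when
   [phi n < n], and to 0 otherwise. *)
Lemma regressive_not_ros (L : (nat -> K) -> K) (C : R) (phi : nat -> nat)
    (G : set (set nat)) : summation abs L C -> 0 < C ->
  (forall A, G A -> exists m n, [/\ A m, A n, (m < n)%N & phi n = m]) ->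
  ~ ros_family abs G.
Proof.
move=> [Llin Lbound L1] C0 Gphi [_ rosG].
pose mask m (f : nat -> K) n : K := if (m < n)%N && (phi n == m) then f n else 0.
have abs0 : abs 0 = 0 := modulus_nat absP 0.
have mask_le m f n : abs (mask m f n) <= abs (f n).
  by rewrite /mask; case: ifP => // _; rewrite abs0 modulus_ge0.
have ell_mask m f : ell1 abs f -> ell1 abs (mask m f).
  by move=> /(ell1_mono absP (mask_le m f)).
pose T f m := L (mask m f).
(* Each index [n] survives in at most one mask, that of [phi n], so the norms of all masks of [f]
   add up to at most the norm of [f]. *)
have normT f : ell1 abs f -> (ell1_norm abs (T f) <= C%:E * ell1_norm abs f)%E.
  move=> ellf; apply: (@le_trans _ _
      (\sum_(0 <= m <oo) (C%:E * ell1_norm abs (mask m f)))%E).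
    apply: lee_nneseries => m _; first by rewrite lee_fin modulus_ge0.
    by apply: Lbound; exact: ell_mask.
  rewrite nneseriesZl; last by move=> m _; exact: ell1_norm_ge0.
  apply: lee_wpmul2l; first by rewrite lee_fin ltW.
  rewrite /ell1_norm nneseries_interchange; last first.
    by move=> m n; rewrite lee_fin modulus_ge0.
  apply: lee_nneseries => [n _ _|n _].
    by apply: nneseries_ge0 => m _ _; rewrite lee_fin modulus_ge0.
  rewrite (@nneseriesD1 _ _ (phi n)) //; last by move=> m _; rewrite lee_fin modulus_ge0.
  rewrite eseries0 ?adde0 ?lee_fin // => m _ /=.
  by rewrite /mask eq_sym => /negbTE->; rewrite andbF abs0.
have normT1 : (op_norm abs T <= C%:E)%E.
  apply: ge_ereal_sup => _ [f f1 <-].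
  apply: le_trans (normT f _) _; first by apply/(ell1P absP); exists 1.
  by rewrite -[leRHS]mule1; apply: lee_wpmul2l => //; rewrite lee_fin ltW.
have Tbd : bounded_operator abs T.
  split; last exact: le_lt_trans normT1 (ltry C).
  - move=> f ellf; apply: le_lt_trans (normT f ellf) _.
    by apply: lte_mul_pinfty => //; rewrite lee_fin ltW.
  - move=> a f g ellf ellg; apply/funext => m; rewrite /T.
    rewrite -Llin; [|exact: ell_mask|exact: ell_mask].
    congr L; apply/funext => n; rewrite /mask; case: ifP => // _.
    by rewrite mulr0 addr0.
have L0 : L (fun=> 0) = 0.
  have ell0 := ell1_cst0 absP; have := Llin 1 _ _ ell0 ell0.
  rewrite (_ : (fun n => _) = fun=> 0) => [LE|]; last first.
    by apply/funext => n; rewrite mulr0 addr0.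
  by move: LE; rewrite mul1r => /eqP; rewrite -subr_eq subrr => /eqP.
have Tdiag : zero_diagonal T.
  move=> n; rewrite /T (_ : mask n _ = fun=> 0) //; apply/funext => i.
  rewrite /mask indicE; case: ifP => // /andP[ni _]; rewrite memNset //= => ni'.
  by rewrite ni' ltnn in ni.
(* As [T] has norm at most [C], membership in [Ros] would bound the compression by 1/2; yet it sends
   the basis vector [n] to one with value 1 at [m]. *)
have [|A [GA [_]]] := rosG T (2 * C)^-1 Tbd Tdiag; first by rewrite invr_gt0 mulr_gt0.
have [m [n [Am An mn phin]]] := Gphi A GA.
apply/negP; rewrite -ltNge; apply: (@lt_le_trans _ _ 1%:E).
  apply: (@le_lt_trans _ _ ((2 * C)^-1%:E * C%:E)%E).
    by apply: lee_wpmul2l => //; rewrite lee_fin invr_ge0 mulr_ge0 // ltW.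
  rewrite -EFinM lte_fin mulrC ltr_pdivrMr ?mulr_gt0 //; lra.
apply: (@le_trans _ _ (ell1_norm abs ((restr A \o T \o restr A) \1_[set n]))); last first.
  by apply: ereal_sup_ubound; exists \1_[set n] => //; exact: ell1_norm_indic.
have -> : 1%:E = (abs ((restr A \o T \o restr A) \1_[set n] m))%:E :> \bar R.
  congr EFin; rewrite /= {1}/restr indicE mem_set //= mulr1 /T.
  rewrite (_ : mask m _ = \1_[set n]) ?L1 ?(modulus_nat absP 1) //.
  apply/funext => i; rewrite /mask /restr !indicE.
  have [->|ni] := eqVneq i n; first by rewrite !mem_set //= mn phin eqxx mulr1.
  rewrite [i \in [set n]]memNset ?mul0r ?if_same //= => ni'.
  by rewrite ni' eqxx in ni.
rewrite -[leLHS](_ : \sum_(m <= i < m.+1)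
    (abs ((restr A \o T \o restr A) \1_[set n] i))%:E = _)%E; last first.
  by rewrite big_nat1.
apply: le_trans (nneseries_lim_ge m.+1 _); last by move=> i _ _; rewrite lee_fin modulus_ge0.
rewrite (@big_cat_nat _ _ _ m 0 m.+1) //= leeDr // sume_ge0 // => i _.
by rewrite lee_fin modulus_ge0.
Qed.

Lemma ros_eq_reaping (L : (nat -> K) -> K) (C : R) : summation abs L C -> 0 < C ->
  exists k, is_ros_ell1 abs k /\ is_reaping_number k.
Proof.
move=> LC C0.
have reap0 : reaping_family [set A : set nat | infinite_set A].
  split=> // -[S split_S].
  have [|SS _] := split_S setT; first exact: infinite_nat.
  have [_] := split_S _ SS; apply; rewrite setTI setDv; exact: finite_set0.
have [|F RF Fmin] := @least_cardinality _ reaping_family; first by eexists; exact: reap0.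
have Fros G : ros_family abs G -> F #<= G.
  move=> rosG; apply: contrapT => nFG.
  have [|H HG RH|phi phiP] := @regressive_guess G; first by case: rosG.
    by apply: nFG; exact: card_le_trans (Fmin H RH) HG.
  exact: regressive_not_ros LC C0 phiP rosG.
have [G [Ginf GF Ghom]] := reaping_homogeneous RF.
have rosG := homogeneous_ros Ginf Ghom.
(* The least reaping family [F] represents both cardinals: [G] is a [ros_family] with [G #<= F], and
   [Fros] gives the converse. *)
exists F; split; split=> //; last by exists F.
by exists G => //; apply: Cantor_Bernstein => //; exact: Fros.
Qed.

End ros.

(** * Real and complex scalars *)

Section scalars.
Context {R : realType}.

Lemma real_modulus : modulus (@real_abs R).
Proof.
split=> [x|x y|x y|n]; rewrite /real_abs.
- exact: normr_ge0.
- exact: ler_normD.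
- exact: normrM.
- exact: normr_nat.
Qed.

Lemma abs_summable_cvg (u : nat -> R) (r : R) :
  (forall M, \sum_(0 <= n < M) `|u n| <= r) ->
  cvgn (series u) /\ `|limn (series u)| <= r.
Proof.
move=> ur; have cu : cvgn [normed series u].
  apply: nondecreasing_is_cvgn; first by apply: nondecreasing_series => n _ _; exact: normr_ge0.
  by exists r => _ [n _ <-]; exact: ur.
split; first exact: normed_cvg.
apply: le_trans (lim_series_norm cu) _; apply: limr_le => //.
by apply: nearW => M; exact: ur.
Qed.

Lemma lim_series_lin (a : R) (u v : nat -> R) : cvgn (series u) -> cvgn (series v) ->
  cvgn (series (fun n => a * u n + v n)) /\
  limn (series (fun n => a * u n + v n)) = a * limn (series u) + limn (series v).
Proof.
move=> cu cv.
have cau := @is_cvg_seriesZ _ u a cu.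
split; first exact: (is_cvg_seriesD cau cv).
by rewrite -[a * _](@lim_seriesZ _ u a cu) -lim_seriesD.
Qed.

Lemma lim_series_indic (k : nat) (c : nat -> R) :
  (forall n, n != k -> c n = 0) -> limn (series c) = c k.
Proof.
move=> c0; apply: cvg_lim => //; apply: cvg_near_cst; near=> M.
have kM : (k < M)%N by near: M; exact: nbhs_infty_gt.
rewrite /series /= (bigD1_seq k) ?iota_uniq ?mem_index_iota //=.
by rewrite big1 ?addr0.
Unshelve. all: by end_near. Qed.

Lemma ell1_real f : ell1 (@real_abs R) f -> cvgn (series f).
Proof.
move=> /(ell1P real_modulus)[r /(ell1_norm_leP real_modulus) fr].
exact: (abs_summable_cvg fr).1.
Qed.

Lemma real_summation : summation (@real_abs R) (fun f => limn (series f)) 1.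
Proof.
split=> [a f g /ell1_real cf /ell1_real cg|f fy|n].
- exact: (lim_series_lin a cf cg).2.
- have fin : ell1_norm (@real_abs R) f \is a fin_num.
    by rewrite ge0_fin_numE // (ell1_norm_ge0 real_modulus).
  rewrite mul1e -(fineK fin) lee_fin; apply: (abs_summable_cvg _).2.
  by apply: (ell1_norm_leP real_modulus _ _).1; rewrite fineK.
- rewrite (@lim_series_indic n) ?indicE ?mem_set // => i ni.
  by rewrite indicE memNset //= => ni'; rewrite ni' eqxx in ni.
Qed.

Local Open Scope complex_scope.

Lemma complex_modulus : modulus (@complex_abs R).
Proof.
split=> [[a b]|x y|x y|n].
- exact: sqrtr_ge0.
- exact: le_normcD.
- exact: Normc.normcM.
- by rewrite /complex_abs normr_nat raddfMn.
Qed.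

Lemma complex_abs_ge_Re (z : R[i]) : `|complex.Re z| <= complex_abs z.
Proof.
case: z => a b; rewrite /complex_abs /= -sqrtr_sqr ler_wsqrtr //.
by rewrite lerDl sqr_ge0.
Qed.

Lemma complex_abs_ge_Im (z : R[i]) : `|complex.Im z| <= complex_abs z.
Proof.
case: z => a b; rewrite /complex_abs /= -sqrtr_sqr ler_wsqrtr //.
by rewrite lerDr sqr_ge0.
Qed.

Lemma complex_abs_le (a b : R) : complex_abs (a +i* b) <= `|a| + `|b|.
Proof.
rewrite /complex_abs /= -[leRHS]ger0_norm ?addr_ge0 // -sqrtr_sqr ler_wsqrtr //.
by rewrite sqrrD !real_normK ?num_real // lerD2r lerDl mulrn_wge0 // mulr_ge0.
Qed.

Lemma ell1_complex (f : nat -> R[i]) (r : R) :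
  (ell1_norm (@complex_abs R) f <= r%:E)%E ->
  (forall M, \sum_(0 <= n < M) `|complex.Re (f n)| <= r) /\
  (forall M, \sum_(0 <= n < M) `|complex.Im (f n)| <= r).
Proof.
move=> /(ell1_norm_leP complex_modulus) fr; split=> M; apply: le_trans (fr M).
  by apply: ler_sum => n _; exact: complex_abs_ge_Re.
by apply: ler_sum => n _; exact: complex_abs_ge_Im.
Qed.

(** Real and imaginary parts are summed separately, and each sum is bounded by the norm; hence the
    constant 2. *)
Lemma complex_summation : summation (@complex_abs R) (fun f =>
  limn (series (fun n => complex.Re (f n))) +i*
  limn (series (fun n => complex.Im (f n)))) 2.
Proof.
split=> [a f g|f fy|n].
- move=> /(ell1P complex_modulus)[r /ell1_complex[fRe fIm]].
  move=> /(ell1P complex_modulus)[s /ell1_complex[gRe gIm]].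
  have [cfR _] := abs_summable_cvg fRe; have [cfI _] := abs_summable_cvg fIm.
  have [cgR _] := abs_summable_cvg gRe; have [cgI _] := abs_summable_cvg gIm.
  case: a => a b.
  have [cR LR] := lim_series_lin (- b) cfI cgR.
  have [cI LI] := lim_series_lin b cfR cgI.
  have [_ LR'] := lim_series_lin a cfR cR.
  have [_ LI'] := lim_series_lin a cfI cI.
  (* Nesting the products in this way expresses each part by two applications of [lim_series_lin]
     with real coefficients. *)
  have RE n : complex.Re ((a +i* b) * f n + g n) =
      a * complex.Re (f n) + (- b * complex.Im (f n) + complex.Re (g n)).
    by case: (f n) (g n) => [x y] [z w] /=; ring.
  have IE n : complex.Im ((a +i* b) * f n + g n) =
      a * complex.Im (f n) + (b * complex.Re (f n) + complex.Im (g n)).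
    by case: (f n) (g n) => [x y] [z w] /=; ring.
  under eq_fun do rewrite RE; under [in X in _ +i* X]eq_fun do rewrite IE.
  rewrite LR' LI' LR LI; apply/eqP; rewrite eq_complex /=.
  by apply/andP; split; apply/eqP; ring.
- have fin : ell1_norm (@complex_abs R) f \is a fin_num.
    by rewrite ge0_fin_numE // (ell1_norm_ge0 complex_modulus).
  have [|fRe fIm] := @ell1_complex f (fine (ell1_norm (@complex_abs R) f)).
    by rewrite fineK.
  rewrite -(fineK fin) -EFinM lee_fin mulr2n mulrDl !mul1r.
  apply: le_trans (complex_abs_le _ _) _; apply: lerD.
    exact: (abs_summable_cvg fRe).2.
  exact: (abs_summable_cvg fIm).2.
- have indicN i : i != n -> \1_[set n] i = 0 :> R[i].
    by move=> ni; rewrite indicE memNset //= => ni'; rewrite ni' eqxx in ni.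
  rewrite !(@lim_series_indic n); last 2 first.
  + by move=> i /indicN->.
  + by move=> i /indicN->.
  by rewrite indicE mem_set.
Qed.

End scalars.
Theorem theorem4p9 (R : realType) :
  (exists k : set (set nat),
     is_ros_ell1 (@real_abs R) k /\ is_reaping_number k) /\
  (exists k : set (set nat),
     is_ros_ell1 (@complex_abs R) k /\ is_reaping_number k).
Proof.
split.
  by apply: (ros_eq_reaping real_modulus real_summation).
by apply: (ros_eq_reaping complex_modulus complex_summation).
Qed.
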